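(* Assume that $R_2(\boldsymbol\mu,\mathbf t)$ does not depend on the unknown $\boldsymbol\mu$. Let $\widehat{\boldsymbol\mu}^*\in\Gamma$. Then the constrained estimator $\widehat{\boldsymbol\mu}^{C}(\widehat{\boldsymbol\mu}^*,\mathbf t)$ is minimax within $\Gamma_C$ (with respect to the risk $R$) if and only if $\widehat{\boldsymbol\mu}^*$ is minimax in $\Gamma$ in terms of the risk $R_1(\boldsymbol\mu,\widehat{\boldsymbol\mu})$.
   Context: Model: $\mathbf y=\boldsymbol\mu+\boldsymbol\epsilon$, where $\mathbf y,\boldsymbol\mu,\boldsymbol\epsilon\in\mathbb R^k$, $\boldsymbol\mu$ is an unknown mean vector and $\boldsymbol\epsilon$ is a random error vector (normality is not assumed). $E[\cdot\,|\,\boldsymbol\mu]$ is expectation over $\mathbf y$ for given $\boldsymbol\mu$. $\mathbf Q$ is a fixed $k\times k$ (symmetric) positive definite matrix; $\mathbf W$ is a fixed $k\times m$ matrix of rank $m$, $m<k$; $\mathbf t=\mathbf t(\mathbf y)$ is a given function from $\mathbb R^k$ to $\mathbb R^m$, with finite second moments given $\boldsymbol\mu$. The benchmark constraint is $\mathbf W'\widehat{\boldsymbol\mu}=\mathbf t(\mathbf y)$. $\Gamma$ is the class of estimators $\widehat{\boldsymbol\mu}=\widehat{\boldsymbol\mu}(\mathbf y)$ of $\boldsymbol\mu$ with $E[\widehat{\boldsymbol\mu}'\widehat{\boldsymbol\mu}\,|\,\boldsymbol\mu]<\infty$. The constrained estimator based on $\widehat{\boldsymbol\mu}$ is $$\widehat{\boldsymbol\mu}^{C}(\widehat{\boldsymbol\mu},\mathbf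 t)=\widehat{\boldsymbol\mu}+\mathbf Q^{-1}\mathbf W(\mathbf W'\mathbf Q^{-1}\mathbf W)^{-1}\{\mathbf t(\mathbf y)-\mathbf W'\widehat{\boldsymbol\mu}\},$$ $\Gamma_C=\{\widehat{\boldsymbol\mu}^{C}(\widehat{\boldsymbol\mu},\mathbf t)\,|\,\widehat{\boldsymbol\mu}\in\Gamma\}$, and $\mathbf P_{\mathbf W}=\mathbf Q^{-1}\mathbf W(\mathbf W'\mathbf Q^{-1}\mathbf W)^{-1}\mathbf W'$. The risks are $$R(\boldsymbol\mu,\widehat{\boldsymbol\mu})=E[(\widehat{\boldsymbol\mu}-\boldsymbol\mu)'\mathbf Q(\widehat{\boldsymbol\mu}-\boldsymbol\mu)\,|\,\boldsymbol\mu],\qquad R_1(\boldsymbol\mu,\widehat{\boldsymbol\mu})=E[(\widehat{\boldsymbol\mu}-\boldsymbol\mu)'\mathbf Q(\mathbf I-\mathbf P_{\mathbf W})(\widehat{\boldsymbol\mu}-\boldsymbol\mu)\,|\,\boldsymbol\mu],$$ $$R_2(\boldsymbol\mu,\mathbf t)=E[(\mathbf t(\mathbf y)-\mathbf W'\boldsymbol\mu)'(\mathbf W'\mathbf Q^{-1}\mathbf W)^{-1}(\mathbf t(\mathbf y)-\mathbf W'\boldsymbol\mu)\,|\,\boldsymbol\mu].$$ An estimator in a class $\mathcal C$ is minimax in $\mathcal C$ in terms of a risk if its supremum of the risk over $\boldsymbol\mu$ equals the infimum over $\mathcal C$ of such suprema. *)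

(* Defs.v *)
From HB Require Import structures.
From mathcomp Require Import all_boot all_order all_algebra.
From mathcomp Require Import all_classical all_reals all_analysis.
Set Implicit Arguments.
Unset Strict Implicit.
Unset Printing Implicit Defensive.
Import Order.TTheory GRing.Theory Num.Theory.
Import numFieldNormedType.Exports.
Local Open Scope classical_set_scope.
Local Open Scope ring_scope.

(* The Borel sigma-algebra on real matrices, hence on 'cV[R]_n. *)
HB.instance Definition _ (R : realType) (m n : nat) :=
  @isMeasurable.Build (sigma_display (@open 'M[R]_(m, n))) 'M[R]_(m, n)
    <<s @open 'M[R]_(m, n) >> (@sigma_algebra0 _ setT _)
    (@sigma_algebraC _ _) (@sigma_algebra_bigcup _ setT _).

Definition sqnorm (R : realType) (n : nat) (x : 'cV[R]_n) : R :=
  (x^T *m x) 0 0.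

Definition qform (R : realType) (n : nat) (A : 'M[R]_n) (x : 'cV[R]_n) : R :=
  (x^T *m A *m x) 0 0.

Definition posdefmx (R : realType) (n : nat) (A : 'M[R]_n) : Prop :=
  A^T = A /\ forall x : 'cV[R]_n, x != 0 -> 0 < qform A x.

Section Model.
Context (R : realType) (d : measure_display) (Omega : measurableType d).
Context (k : nat).
(* [P mu] is the probability given the parameter mu: the law of the error
   vector is allowed to depend on mu. *)
Variables (P : 'cV[R]_k -> probability Omega R).
Variables (eps : {mfun Omega >-> 'cV[R]_k}).

Definition obs (mu : 'cV[R]_k) (w : Omega) : 'cV[R]_k := mu + eps w.

(* E[f(y) | mu] *)
Definition cond_expectation (mu : 'cV[R]_k) (f : 'cV[R]_k -> R) : \bar R :=
  'E_(P mu)[f \o obs mu]%E.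

Definition mean_vector : Prop :=
  forall (mu : 'cV[R]_k) (i : 'I_k),
    (P mu).-integrable setT (EFin \o (fun w => obs mu w i 0)) /\
    cond_expectation mu (fun y => y i 0) = (mu i 0)%:E.

Definition finite_second_moment (n : nat) (f : 'cV[R]_k -> 'cV[R]_n) : Prop :=
  measurable_fun setT f /\
  forall mu : 'cV[R]_k,
    (cond_expectation mu (fun y => sqnorm (f y)) < +oo)%E.

Definition Gamma : set ('cV[R]_k -> 'cV[R]_k) :=
  [set muhat | finite_second_moment muhat].

Variables (m : nat) (Q : 'M[R]_k) (W : 'M[R]_(k, m)).
Variable (t : 'cV[R]_k -> 'cV[R]_m).

Definition constrained (muhat : 'cV[R]_k -> 'cV[R]_k) (y : 'cV[R]_k) :
    'cV[R]_k :=
  muhat y + invmx Q *m W *m invmx (W^T *m invmx Q *m W)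
              *m (t y - W^T *m muhat y).

Definition Gamma_C : set ('cV[R]_k -> 'cV[R]_k) := constrained @` Gamma.

Definition P_W : 'M[R]_k :=
  invmx Q *m W *m invmx (W^T *m invmx Q *m W) *m W^T.

Definition risk (mu : 'cV[R]_k) (muhat : 'cV[R]_k -> 'cV[R]_k) : \bar R :=
  cond_expectation mu (fun y => qform Q (muhat y - mu)).

Definition risk1 (mu : 'cV[R]_k) (muhat : 'cV[R]_k -> 'cV[R]_k) : \bar R :=
  cond_expectation mu (fun y => qform (Q *m (1%:M - P_W)) (muhat y - mu)).

Definition risk2 (mu : 'cV[R]_k) : \bar R :=
  cond_expectation mu
    (fun y => qform (invmx (W^T *m invmx Q *m W)) (t y - W^T *m mu)).

End Model.

Definition sup_risk (R : realType) (T E : Type) (r : T -> E -> \bar R)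
    (delta : E) : \bar R :=
  ereal_sup (range (fun mu => r mu delta)).

Definition minimax (R : realType) (T E : Type) (C : set E)
    (r : T -> E -> \bar R) (delta : E) : Prop :=
  C delta /\ sup_risk r delta = ereal_inf (sup_risk r @` C).

(* Main.v *)
Require Import Defs.
From HB Require Import structures.
From mathcomp Require Import all_boot all_order all_algebra.
From mathcomp Require Import all_classical all_reals all_analysis.
From mathcomp Require Import measurable_realfun ring lra.
Set Implicit Arguments.
Unset Strict Implicit.
Unset Printing Implicit Defensive.
Import Order.TTheory GRing.Theory Num.Theory.
Import numFieldNormedType.Exports.
Local Open Scope classical_set_scope.
Local Open Scope ring_scope.

(** Constraining an estimator overwrites its component along the range of
    Q^-1 W and leaves the Q-orthogonal component, which lies in the kernel of
    W', untouched.  By Pythagoras for the inner product of Q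
    ([qform_constrained]), the loss of the constrained estimator is the sum of
    the loss of the original one measured by Q (I - P_W), and of the loss of t
    as an estimator of W' mu, which no longer involves the estimator.  Both
    terms are nonnegative, so expectations add up even when they are infinite
    ([risk_constrained]): R = R_1 + R_2.

    By hypothesis R_2 is a constant c, and the second moments of t make c
    finite ([risk2_fin_num]).  Translation by a real number is injective on
    the extended reals and commutes with suprema and infima.
    Hence passing from an estimator to its constrained version shifts every
    worst-case risk, and the minimax value of the class, by the same real c, so
    that equality with the minimax value is preserved in both directions
    ([minimax_image_addr]). *)

(** * Minimaxity under a translation of the risk *)

Lemma ereal_sup_addr (R : realType) (c : R) (S : set (\bar R)) :
  (ereal_sup [set x + c%:E | x in S] = ereal_sup S + c%:E)%E.
Proof.
apply/eqP; rewrite eq_le; apply/andP; split.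
  apply: ge_ereal_sup => _ [x Sx <-].
  by apply: leeD2r; exact: ereal_sup_ubound.
rewrite -leeBrDr //; apply: ge_ereal_sup => x Sx.
by rewrite leeBrDr //; apply: ereal_sup_ubound; exists x.
Qed.

Lemma ereal_inf_addr (R : realType) (c : R) (S : set (\bar R)) :
  (ereal_inf [set x + c%:E | x in S] = ereal_inf S + c%:E)%E.
Proof.
apply/eqP; rewrite eq_le; apply/andP; split.
  rewrite -leeBlDr //; apply: le_ereal_inf_tmp => x Sx.
  by rewrite leeBlDr //; apply: ereal_inf_lbound; exists x.
apply: le_ereal_inf_tmp => _ [x Sx <-].
by apply: leeD2r; exact: ereal_inf_lbound.
Qed.

(** The infimum over [f @` C] runs over the worst-case risks of the [f e], which
    are those of the [e] in [C] translated by the real number [c]; cancelling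
    [c] gives the converse direction. *)
Lemma minimax_image_addr (R : realType) (T E F : Type) (C : set E)
    (f : E -> F) (r : T -> F -> \bar R) (s : T -> E -> \bar R) (c : R) :
  (forall mu e, C e -> r mu (f e) = (s mu e + c%:E)%E) ->
  forall x, C x -> minimax (f @` C) r (f x) <-> minimax C s x.
Proof.
move=> rs x Cx.
have sup_shift e : C e -> sup_risk r (f e) = (sup_risk s e + c%:E)%E.
  move=> Ce; rewrite /sup_risk -ereal_sup_addr image_comp.
  by congr ereal_sup; apply: eq_imagel => mu _ /=; rewrite rs.
have inf_shift : ereal_inf (sup_risk r @` (f @` C)) =
    (ereal_inf (sup_risk s @` C) + c%:E)%E.
  rewrite -ereal_inf_addr !image_comp.
  by congr ereal_inf; apply: eq_imagel => e Ce /=; rewrite sup_shift.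
rewrite /minimax inf_shift sup_shift //; split=> -[_ e]; split => //.
- by rewrite -[LHS](@addeK _ c%:E) // e addeK.
- by rewrite e.
Qed.

(** * Quadratic forms and positive definite matrices *)

Section QuadraticForms.
Variable R : realType.

Lemma qformE n (A : 'M[R]_n) (x : 'cV[R]_n) :
  qform A x = \sum_j \sum_i x i 0 * A i j * x j 0.
Proof.
rewrite /qform !mxE; apply: eq_bigr => j _.
rewrite !mxE big_distrl /=; apply: eq_bigr => i _.
by rewrite !mxE.
Qed.

Lemma sqnormE n (x : 'cV[R]_n) : sqnorm x = \sum_i x i 0 ^+ 2.
Proof.
by rewrite /sqnorm !mxE; apply: eq_bigr => i _; rewrite !mxE expr2.
Qed.

Lemma sqnorm_ge0 n (x : 'cV[R]_n) : 0 <= sqnorm x.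
Proof. by rewrite sqnormE; apply: sumr_ge0 => i _; exact: sqr_ge0. Qed.

(** The gap between the two sides is [sqnorm (x + y)]. *)
Lemma sqnormB_le n (x y : 'cV[R]_n) :
  sqnorm (x - y) <= 2 * (sqnorm x + sqnorm y).
Proof.
rewrite !sqnormE -big_split mulr_sumr; apply: ler_sum => i _ /=.
rewrite !mxE -subr_ge0.
have -> : 2 * (x i 0 ^+ 2 + y i 0 ^+ 2) - (x i 0 - y i 0) ^+ 2 =
  (x i 0 + y i 0) ^+ 2 by ring.
exact: sqr_ge0.
Qed.

(** This crude comparison turns a finite second moment into a finite expected
    quadratic loss, whatever the matrix of the loss. *)
Lemma qform_le_sqnorm n (A : 'M[R]_n) (x : 'cV[R]_n) :
  qform A x <= (\sum_j \sum_i `|A i j|) * sqnorm x.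
Proof.
rewrite qformE mulr_suml; apply: ler_sum => j _.
rewrite mulr_suml; apply: ler_sum => i _.
have coord_le l : `|x l 0| ^+ 2 <= sqnorm x.
  rewrite real_normK ?num_real // sqnormE (bigD1 l) //= lerDl.
  by apply: sumr_ge0 => ? _; exact: sqr_ge0.
apply: le_trans (ler_norm _) _; rewrite !normrM.
rewrite mulrAC [leLHS]mulrC; apply: ler_wpM2l => //.
(* Arithmetic-geometric mean inequality for the two coordinates. *)
have := coord_le i; have := coord_le j.
have := sqr_ge0 (`|x i 0| - `|x j 0|).
nra.
Qed.

Lemma posdef_qform_ge0 n (A : 'M[R]_n) (x : 'cV[R]_n) :
  posdefmx A -> 0 <= qform A x.
Proof.
move=> [_ A_gt0]; have [->|/A_gt0/ltW//] := eqVneq x 0.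
by rewrite /qform mulmx0 mxE.
Qed.

Lemma posdef_unitmx n (A : 'M[R]_n) : posdefmx A -> A \in unitmx.
Proof.
move=> [_ A_gt0]; rewrite -row_free_unit; apply/inj_row_free => v vA0.
apply/eqP; rewrite -[_ == _](inj_eq trmx_inj) trmx0.
apply/negPn/negP => /A_gt0; rewrite /qform trmxK vA0 mul0mx mxE.
by rewrite ltxx.
Qed.

Lemma posdef_invmx n (A : 'M[R]_n) : posdefmx A -> posdefmx (invmx A).
Proof.
move=> A_pd; have A_unit := posdef_unitmx A_pd; have [A_sym A_gt0] := A_pd.
split=> [|x x_neq0]; first by rewrite trmx_inv A_sym.
have -> : qform (invmx A) x = qform A (invmx A *m x).
  by rewrite /qform trmx_mul trmx_inv A_sym -!mulmxA (mulKVmx A_unit).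
apply: A_gt0; apply: contra x_neq0 => /eqP Ax0.
by rewrite -(mulKVmx A_unit x) Ax0 mulmx0.
Qed.

(** The rank condition makes [W] injective on column vectors, so that
    the form of [A] evaluated at [W *m x] vanishes only at [x = 0]. *)
Lemma posdef_congr n p (A : 'M[R]_n) (W : 'M[R]_(n, p)) :
  posdefmx A -> \rank W = p -> posdefmx (W^T *m A *m W).
Proof.
move=> [A_sym A_gt0] rank_W; split=> [|x x_neq0].
  by rewrite !trmx_mul trmxK A_sym mulmxA.
have -> : qform (W^T *m A *m W) x = qform A (W *m x).
  by rewrite /qform trmx_mul !mulmxA.
apply: A_gt0; apply: contra x_neq0 => /eqP Wx0.
have WT_free : row_free W^T by rewrite /row_free mxrank_tr rank_W.
rewrite -[_ == _](inj_eq trmx_inj) trmx0 -(mulmx_free_eq0 _ WT_free).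
by rewrite -trmx_mul Wx0 trmx0.
Qed.

End QuadraticForms.

(** * Orthogonal decomposition of the loss *)

(** Two properties of [G] drive the decomposition: it lifts the constraint
    values ([gain_section]), and, up to [B], it is the adjoint of [W^T] for the inner
    product of the symmetric matrix [Q] ([gain_adjoint]).  Then [G *m W^T] is
    the [Q]-orthogonal projection along the kernel of [W^T]. *)
Section GainDecomposition.
Variables (R : realType) (k m : nat) (Q : 'M[R]_k) (W G : 'M[R]_(k, m)).
Variable B : 'M[R]_m.
Hypotheses (Q_sym : Q^T = Q) (gain_adjoint : G^T *m Q = B *m W^T).
Hypothesis gain_section : W^T *m G = 1%:M.

Lemma qform_gain (u : 'cV[R]_m) : qform Q (G *m u) = qform B u.
Proof.
rewrite /qform trmx_mul -(mulmxA u^T _ Q) gain_adjoint -!mulmxA.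
by rewrite (mulmxA W^T) gain_section mul1mx.
Qed.

Lemma constraint_residual : W^T *m (1%:M - G *m W^T) = 0.
Proof. by rewrite mulmxBr mulmx1 mulmxA gain_section mul1mx subrr. Qed.

(** The range of [G] is [Q]-orthogonal to the kernel of [W^T], which is the
    range of the residual projection. *)
Lemma gain_orthogonal : G^T *m Q *m (1%:M - G *m W^T) = 0.
Proof. by rewrite gain_adjoint -mulmxA constraint_residual mulmx0. Qed.

(** The residual projection is idempotent and self-adjoint for [Q]. *)
Lemma qform_residual (x : 'cV[R]_k) :
  qform Q ((1%:M - G *m W^T) *m x) = qform (Q *m (1%:M - G *m W^T)) x.
Proof.
have residualT : (1%:M - G *m W^T)^T *m Q *m (1%:M - G *m W^T) =
    Q *m (1%:M - G *m W^T).
  rewrite [X in X *m Q *m _]linearB /= trmx1 trmx_mul trmxK !mulmxBl mul1mx.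
  by rewrite -!(mulmxA W) gain_orthogonal mulmx0 subr0.
by rewrite /qform trmx_mul -residualT !mulmxA.
Qed.

(** Pythagoras: the cross terms vanish by [gain_orthogonal]. *)
Lemma qform_residualDgain (x : 'cV[R]_k) (u : 'cV[R]_m) :
  qform Q ((1%:M - G *m W^T) *m x + G *m u) =
  qform (Q *m (1%:M - G *m W^T)) x + qform B u.
Proof.
rewrite -qform_residual -qform_gain.
move: (1%:M - G *m W^T) gain_orthogonal => D GQD0.
have cross : (G *m u)^T *m Q *m (D *m x) = 0.
  rewrite trmx_mul (mulmxA _ D) -(mulmxA u^T _ Q) -(mulmxA u^T _ D).
  by rewrite GQD0 mulmx0 mul0mx.
have crossT : (D *m x)^T *m Q *m (G *m u) = 0.
  apply: trmx_inj; rewrite trmx0 -[RHS]cross [LHS]trmx_mul.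
  by rewrite [(_ *m Q)^T]trmx_mul trmxK Q_sym mulmxA.
rewrite {1}/qform [(_ + _)^T]linearD !mulmxDl !mulmxDr cross crossT.
by rewrite addr0 add0r mxE.
Qed.

End GainDecomposition.

Section Decomposition.
Variables (R : realType) (k m : nat) (Q : 'M[R]_k) (W : 'M[R]_(k, m)).
Hypotheses (Q_pd : posdefmx Q) (rank_W : \rank W = m).

(** The lift of constraint values used by [constrained]; in particular [P_W Q W]
    is [gain *m W^T] by definition. *)
Definition gain : 'M[R]_(k, m) :=
  invmx Q *m W *m invmx (W^T *m invmx Q *m W).

Lemma gram_posdef : posdefmx (W^T *m invmx Q *m W).
Proof. by apply: posdef_congr => //; exact: posdef_invmx. Qed.

Lemma gainTM : gain^T *m Q = invmx (W^T *m invmx Q *m W) *m W^T.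
Proof.
rewrite /gain !trmx_mul (posdef_invmx gram_posdef).1 (posdef_invmx Q_pd).1.
by rewrite !mulmxA mulmxKV // posdef_unitmx.
Qed.

Lemma trmx_gain : W^T *m gain = 1%:M.
Proof. by rewrite /gain !mulmxA mulmxV ?(posdef_unitmx gram_posdef). Qed.

Lemma residual_qform_ge0 (x : 'cV[R]_k) :
  0 <= qform (Q *m (1%:M - P_W Q W)) x.
Proof.
by rewrite -(qform_residual gainTM trmx_gain); exact: posdef_qform_ge0.
Qed.

Lemma gram_inv_qform_ge0 (u : 'cV[R]_m) :
  0 <= qform (invmx (W^T *m invmx Q *m W)) u.
Proof. exact: posdef_qform_ge0 (posdef_invmx gram_posdef). Qed.

(** The error of the constrained estimator is the residual projection of the
    original error plus the lift of the error of [t]. *)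
Lemma qform_constrained (t : 'cV[R]_k -> 'cV[R]_m)
    (muhat : 'cV[R]_k -> 'cV[R]_k) (mu y : 'cV[R]_k) :
  qform Q (constrained Q W t muhat y - mu) =
    qform (Q *m (1%:M - P_W Q W)) (muhat y - mu) +
    qform (invmx (W^T *m invmx Q *m W)) (t y - W^T *m mu).
Proof.
rewrite -(qform_residualDgain Q_pd.1 gainTM trmx_gain) /constrained -/gain.
congr qform; move: gain => g; rewrite mulmxBl mul1mx -mulmxA.
have -> : t y - W^T *m muhat y =
    (t y - W^T *m mu) - W^T *m (muhat y - mu).
  by rewrite [W^T *m (_ - mu)]mulmxBr opprB addrA subrK.
by rewrite [g *m (_ - W^T *m _)]mulmxBr addrAC [X in _ = X]addrAC addrA.
Qed.

End Decomposition.

(** * Borel measurability of the losses *)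

Section Measurability.
Variables (R : realType) (d : measure_display) (T : measurableType d).

Lemma measurable_coord m n (i : 'I_m) (j : 'I_n) :
  measurable_fun setT (fun M : 'M[R]_(m, n) => M i j).
Proof.
apply: (measurability _ (RGenOpens.measurableE R)).
move=> _ [_ [a [b ->] <-]]; rewrite setTI; apply: sub_sigma_algebra.
apply: open_comp; last exact: interval_open.
by move=> M _; exact: coord_continuous.
Qed.

Lemma measurable_translation m n (A : 'M[R]_(m, n)) :
  measurable_fun setT (fun M : 'M[R]_(m, n) => A + M).
Proof.
apply: (measurability (@open 'M[R]_(m, n))) => //.
move=> _ [U oU <-]; rewrite setTI; apply: sub_sigma_algebra.
apply: open_comp => // M _.
by apply: continuousD; [exact: cst_continuous|move=> ?].
Qed.

Lemma measurable_qformB n (A : 'M[R]_n) (a : 'cV[R]_n) (f : T -> 'cV[R]_n) :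
  measurable_fun setT f -> measurable_fun setT (fun w => qform A (f w - a)).
Proof.
move=> mf.
have mc i : measurable_fun setT (fun w => (f w - a) i 0).
  under eq_fun do rewrite mxE.
  apply: measurable_funD; last exact: measurable_cst.
  exact: measurableT_comp (measurable_coord i 0) mf.
under eq_fun do rewrite qformE.
apply: measurable_sum => j; apply: measurable_sum => i.
apply: measurable_funM => //; apply: measurable_funM => //.
Qed.

End Measurability.

(** * Risks of constrained estimators *)

Section Risks.
Variables (R : realType) (d : measure_display) (Omega : measurableType d).
Variables (k m : nat) (P : 'cV[R]_k -> probability Omega R).
Variables (eps : {mfun Omega >-> 'cV[R]_k}).
Variables (Q : 'M[R]_k) (W : 'M[R]_(k, m)) (t : 'cV[R]_k -> 'cV[R]_m).
Hypotheses (Q_pd : posdefmx Q) (rank_W : \rank W = m).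
Hypothesis t_moment : finite_second_moment P eps t.

Lemma measurable_obs mu : measurable_fun setT (obs eps mu).
Proof. exact: measurableT_comp (measurable_translation mu) _. Qed.

Lemma measurable_loss n (f : 'cV[R]_k -> 'cV[R]_n) (A : 'M[R]_n)
    (a : 'cV[R]_n) mu : measurable_fun setT f ->
  measurable_fun setT (fun w => (qform A (f (obs eps mu w) - a))%:E).
Proof.
move=> mf; apply/measurable_EFinP; apply: measurable_qformB.
exact: measurableT_comp mf (measurable_obs mu).
Qed.

(** Both losses on the right are nonnegative, so their integrals add up with
    no integrability to check. *)
Lemma risk_constrained mu muhat : Gamma P eps muhat ->
  risk P eps Q mu (constrained Q W t muhat) =
  (risk1 P eps Q W mu muhat + risk2 P eps Q W t mu)%E.
Proof.
move=> [mmuhat _].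
rewrite /risk /risk1 /risk2 /cond_expectation unlock /= -ge0_integralD //=.
- by apply: eq_integral => w _; rewrite -EFinD qform_constrained.
- by move=> w _; rewrite lee_fin residual_qform_ge0.
- exact: measurable_loss.
- by move=> w _; rewrite lee_fin gram_inv_qform_ge0.
- by apply: measurable_loss; case: t_moment.
Qed.

Lemma risk2_fin_num mu : risk2 P eps Q W t mu \is a fin_num.
Proof.
have [mt /(_ mu) t_fin] := t_moment.
set B := invmx (W^T *m invmx Q *m W).
(* By [qform_le_sqnorm] and [sqnormB_le], [K * (sqnorm x + sqnorm y)] bounds
   [qform B (x - y)]. *)
set K := 2 * \sum_j \sum_i `|B i j|.
have K_ge0 : 0 <= K.
  by rewrite mulr_ge0 // sumr_ge0 // => j _; rewrite sumr_ge0.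
move: t_fin; rewrite /risk2 /cond_expectation unlock /= => t_fin.
rewrite ge0_fin_numE; last first.
  by apply: integral_ge0 => w _; rewrite lee_fin gram_inv_qform_ge0.
(* [sqnorm] is the quadratic form of the identity matrix. *)
have msq : measurable_fun setT (fun w => (sqnorm (t (obs eps mu w)))%:E).
  have := @measurable_loss _ t 1%:M 0 mu mt.
  by under eq_fun do rewrite subr0 /qform mulmx1.
apply: (@le_lt_trans _ _
  (\int[P mu]_w (K%:E * ((sqnorm (t (obs eps mu w)))%:E +
                         (sqnorm (W^T *m mu))%:E))%E)%E).
  apply: ge0_le_integral => //=.
  - by move=> w _; rewrite lee_fin gram_inv_qform_ge0.
  - exact: measurable_loss.
  - by apply: emeasurable_funM => //; apply: emeasurable_funD.
  - move=> w _; rewrite lee_fin; apply: le_trans (qform_le_sqnorm _ _) _.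
    rewrite /K [2 * _]mulrC -mulrA; apply: ler_wpM2l; last exact: sqnormB_le.
    by rewrite sumr_ge0 // => j _; rewrite sumr_ge0.
rewrite ge0_integralZl_EFin //=; last 2 first.
- by move=> w _; rewrite lee_fin addr_ge0 ?sqnorm_ge0.
- by apply: emeasurable_funD.
rewrite ge0_integralD //=; last 2 first.
- by move=> w _; rewrite lee_fin sqnorm_ge0.
- by move=> w _; rewrite lee_fin sqnorm_ge0.
rewrite integral_cst //= probability_setT mule1.
rewrite lte_mul_pinfty // ?lee_fin //.
by rewrite lte_add_pinfty // ltry.
Qed.

End Risks.

Theorem proposition2p4 (R : realType) (d : measure_display)
    (Omega : measurableType d) (k m : nat)
    (P : 'cV[R]_k -> probability Omega R)
    (eps : {mfun Omega >-> 'cV[R]_k})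
    (Q : 'M[R]_k) (W : 'M[R]_(k, m)) (t : 'cV[R]_k -> 'cV[R]_m)
    (mean_y : mean_vector P eps)
    (Q_posdef : posdefmx Q)
    (m_lt_k : (m < k)%N)
    (rank_W : \rank W = m)
    (t_moment : finite_second_moment P eps t)
    (risk2_const : forall mu mu' : 'cV[R]_k,
        risk2 P eps Q W t mu = risk2 P eps Q W t mu')
    (muhat : 'cV[R]_k -> 'cV[R]_k)
    (muhat_Gamma : Gamma P eps muhat) :
  minimax (Gamma_C P eps Q W t) (risk P eps Q) (constrained Q W t muhat) <->
  minimax (Gamma P eps) (risk1 P eps Q W) muhat.
Proof.
apply: (@minimax_image_addr _ _ _ _ _ _ _ _ (fine (risk2 P eps Q W t 0))) => //.
move=> mu e Ge; rewrite fineK; last exact: risk2_fin_num.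
by rewrite risk_constrained // (risk2_const mu 0).
Qed.
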